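(* Let $f:\Omega\to\mathbb{R}$ be a Lipschitz potential of product type, $f(x)=\sum_{j=1}^{\infty} f_j(x_j)$, where $f_j:[0,1]\to\mathbb{R}$ are fixed functions, the series converges absolutely for every $x\in\Omega=[0,1]^{\mathbb{N}}$, and the iterated series $\sum_{j=1}^{\infty}\sum_{i>j} f_i(x_j)$ converges (to a finite real number) for every $x\in\Omega$. Let $F(a)=\sum_{i=1}^{\infty} f_i(a)=f(a,a,a,\dots)$, and let $u(x)=\sum_{j=1}^{\infty}\sum_{i>j} f_i(x_j)$, which is a calibrated subaction for $f$. Consider the function $$I(x)=\sum_{j\ge1}\Big(u(\sigma^{j}(x))-u(\sigma^{j-1}(x))-f(\sigma^{j-1}(x))+m(f)\Big),\qquad x\in\Omega.$$ For $\beta>0$ let $\tilde\mu_\beta=\bigotimes_{n=1}^{\infty}\tilde\mu_{0,\beta}$, where $d\tilde\mu_{0,\beta}(a)=\dfrac{e^{\beta F(a)}}{\int_0^1 e^{\beta F(b)}\,db}\,da$ on $[0,1]$. Then: (i) For every $x=(x_1,x_2,\dots)\in\Omega$, $$I(x)=\sum_{j=1}^{\infty}\Big(-\sum_{i=1}^{\infty} f_i(x_j)+m(f)\Big)=\sum_{j=1}^{\infty}\big(-F(x_j)+m(f)\big).$$ (ii) For each cylinder $D=A_1\times\cdots\times A_n$ (that is, $D=\{x\in\Omega: x_k\in A_k,\ 1\le k\le n\}$), where $A_1,\dots,A_n$ are intervals of $[0,1]$, the following limit exists and $$\lim_{\beta\to\infty}\frac1\beta\log\tilde\mu_\beta(D)=-\inf_{x\in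 D} I(x).$$
   Context: $\Omega=[0,1]^{\mathbb{N}}$ is equipped with the metric $d(x,y)=\sum_{n\ge1}|x_n-y_n|/2^n$, and Lipschitz is with respect to $d$. $\sigma:\Omega\to\Omega$ is the shift $\sigma(x_1,x_2,x_3,\dots)=(x_2,x_3,\dots)$, $\sigma^0$ is the identity, and $\mathcal{M}_\sigma$ is the set of $\sigma$-invariant Borel probability measures on $\Omega$. The maximal value is $m(f)=\max_{\mu\in\mathcal{M}_\sigma}\int_\Omega f\,d\mu$. A function $u$ is a calibrated subaction for $f$ if $m(f)=\max_{a\in[0,1]}\{f(ax)+u(ax)-u(x)\}$ for every $x\in\Omega$, where $ax=(a,x_1,x_2,\dots)$. $da$, $db$ denote Lebesgue measure on $[0,1]$. The function $I$ may take the value $+\infty$. Iterated sums $\sum_j\sum_{i>j}$ mean: first sum over $i>j$, then over $j$.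
   Formalization: In (ii) the intervals A_1,…,A_n are taken nondegenerate (each contains two distinct points): for a one-point interval {a} the cylinder has measure 0, so the left side is −∞, while −inf I over it is finite. *)

(* Defs.v *)
From HB Require Import structures.
From mathcomp Require Import all_boot all_order all_algebra.
From mathcomp Require Import all_classical all_reals all_analysis.

Set Implicit Arguments.
Unset Strict Implicit.
Unset Printing Implicit Defensive.

Import Order.TTheory GRing.Theory Num.Theory.
Import numFieldNormedType.Exports.

Local Open Scope classical_set_scope.
Local Open Scope ring_scope.

Notation "\sum_ ( m <= i <oo ) F" :=
  (\big[+%R/0%R]_(m <= i <oo) F%R) : ring_scope.

(* Coordinates are numbered from 0: the coordinate x_n (n >= 1) is [x n.-1]. *)
Definition Omega (R : realType) : Type := nat -> {i01 R}.

HB.instance Definition _ (R : realType) := Choice.on (Omega R).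
HB.instance Definition _ (R : realType) :=
  isPointed.Build (Omega R) (fun=> 0%:i01).

Section Omega.
Variable R : realType.
Implicit Types (x y : Omega R) (f u : Omega R -> R).

Definition dist x y : R :=
  \sum_(0 <= n <oo) (`|\val (x n) - \val (y n)| / 2 ^+ n.+1).

Definition dist_open (U : set (Omega R)) : Prop :=
  forall x, U x ->
    exists2 e : R, 0 < e & forall y, dist x y < e -> U y.

Definition lipschitz_dist f : Prop :=
  exists L : R, forall x y, `|f x - f y| <= L * dist x y.

Definition BorelOmega := g_sigma_algebraType dist_open.

Definition oshift x : Omega R := fun n => x n.+1.

(* the concatenation ax *)
Definition ocons (a : {i01 R}) x : Omega R :=
  fun n => if n is k.+1 then x k else a.

Definition shift_invariant (mu : probability BorelOmega R) : Prop :=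
  forall A : set BorelOmega, measurable A -> mu (oshift @^-1` A) = mu A.

Definition is_max (A : set R) (m : R) : Prop := A m /\ ubound A m.

(* [xget] picks the (unique) maximum; it returns 0 if there is none. *)
Definition max_value f : R :=
  xget 0 (is_max [set r | exists2 mu : probability BorelOmega R,
    shift_invariant mu & r = \int[mu]_x f x]).

Definition calibrated_subaction f u : Prop :=
  forall x, is_max (range (fun a => f (ocons a x) + u (ocons a x) - u x))
                   (max_value f).

Definition rate f u x : \bar R :=
  (\sum_(0 <= j <oo)
     (u (iter j.+1 oshift x) - u (iter j oshift x)
      - f (iter j oshift x) + max_value f)%:E)%E.

(* Only the values of the functions [f_ j : R -> R] on [0, 1] are used. *)
Definition diagonal_sum (f_ : nat -> R -> R) (a : R) : R :=
  \sum_(0 <= i <oo) f_ i a.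

Definition tail_sum (f_ : nat -> R -> R) (j : nat) (a : R) : R :=
  \sum_(j.+1 <= i <oo) f_ i a.

Definition product_subaction (f_ : nat -> R -> R) x : R :=
  \sum_(0 <= j <oo) tail_sum f_ j (\val (x j)).

(* The measure with density e^(beta F) / int_0^1 e^(beta F) with respect to
   Lebesgue measure on [0, 1], seen as a set function on R. *)
Definition gibbs (F : R -> R) (beta : R) (A : set R) : \bar R :=
  (\int[lebesgue_measure]_(a in A `&` `[0%R, 1%R])
    (expR (beta * F a)
     / \int[lebesgue_measure]_(b in `[0%R, 1%R]) expR (beta * F b))%R%:E)%E.

Definition cylinder n (A : 'I_n -> set R) : set (Omega R) :=
  [set x | forall k : 'I_n, A k (\val (x k))].

(* [mu] is the product of countably many copies of [nu]; this determines [mu]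
   since the measurable cylinders form a pi-system generating the Borel sets. *)
Definition is_product_measure (nu : set R -> \bar R)
    (mu : probability BorelOmega R) : Prop :=
  forall n (A : 'I_n -> set R), (forall k, measurable (A k)) ->
    mu (cylinder A) = (\prod_(k < n) nu (A k))%E.

(* The intervals are nondegenerate: for A = {a} with F(a) = m(f), the cylinder A
   has measure zero although the infimum of the rate function on it is 0. *)
Definition interval01 (A : set R) : Prop :=
  [/\ is_interval A, A `<=` `[0, 1] & exists a b, [/\ A a, A b & a < b]].

End Omega.

(* Main.v *)
Require Import Defs.
From mathcomp Require Import all_boot all_order all_algebra.
From mathcomp Require Import all_classical all_reals all_analysis.
From mathcomp Require Import measurable_realfun.
From mathcomp Require Import ring lra.

Set Implicit Arguments.
Unset Strict Implicit.
Unset Printing Implicit Defensive.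

Import Order.TTheory GRing.Theory Num.Theory.
Import numFieldNormedType.Exports.

Local Open Scope classical_set_scope.
Local Open Scope ring_scope.

(** Since [f] is Lipschitz and two sequences that agree before rank [m] are at
    distance O(2^-m), each tail a |-> sum_(i >= m) f_i(a) is Lipschitz with
    constant L/2^m ([tail_lipschitz]).  Hence [F] is Lipschitz for the usual
    distance and [u] is Lipschitz for [dist]; in particular [u] is bounded and
    Borel measurable.

    Shifting the series by one index gives the cohomological identity
    f(x) + u(x) - u(sigma x) = F(x_0) ([subaction_identity]).  It makes each
    term of the rate function equal to m(f) - F(x_j), which is the second
    claim.  Integrating it against an invariant measure gives
    int f dmu = int F(x_0) dmu <= max F, and the Dirac mass at the constant
    sequence of a maximizer of [F] attains the bound, so m(f) = max F
    ([max_valueE]).  With the same identity at the point ax, this says that [u]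
    is a calibrated subaction.

    For the large deviation limit, the logarithm of the measure of a cylinder
    is a finite sum of terms ln int_(A_k) e^(beta F) - ln int_[0,1] e^(beta F).
    Laplace's principle for Lipschitz functions on nondegenerate intervals
    ([laplace_interval]) gives the limit sum_k (sup_(A_k) F - m(f)).  On the
    other side the rate function is a sum over the coordinates of the
    nonnegative costs m(f) - F(x_j), and the coordinates that the cylinder
    leaves free can be put at a maximizer of [F], so its infimum is
    sum_k inf_(A_k) (m(f) - F) ([ereal_inf_cylinder]). *)

(** * Real series *)

Section Series.
Variable R : realType.
Implicit Types g : nat -> R.

Lemma eq_limn (g h : nat -> R) : g =1 h -> limn g = limn h.
Proof. by move=> /funext ->. Qed.

Lemma cvg_sum_from g m : cvgn (series g) ->
  (fun n => \sum_(m <= i < n) g i) @ \oo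
    --> limn (series g) - \sum_(0 <= i < m) g i.
Proof.
move=> cg.
have h : (fun n => series g n - \sum_(0 <= i < m) g i) @ \oo
    --> limn (series g) - \sum_(0 <= i < m) g i.
  by apply: cvgB; [exact: cg | exact: cvg_cst].
apply: cvg_trans h; apply: near_eq_cvg.
exists m => // n /= mn.
by rewrite seriesEnat/= (big_cat_nat (n := m) (p := n))//=; ring.
Qed.

Lemma sum_split g m : cvgn (series g) ->
  \sum_(0 <= i <oo) g i = \sum_(0 <= i < m) g i + \sum_(m <= i <oo) g i.
Proof.
by move=> cg; rewrite (cvg_lim _ (cvg_sum_from (m := m) cg))// addrC subrK.
Qed.

Lemma sum_from_recl g m : cvgn (series g) ->
  \sum_(m <= i <oo) g i = g m + \sum_(m.+1 <= i <oo) g i.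
Proof.
move=> cg.
rewrite (cvg_lim _ (cvg_sum_from (m := m) cg))//.
rewrite (cvg_lim _ (cvg_sum_from (m := m.+1) cg))//.
by rewrite big_nat_recr//=; ring.
Qed.

Lemma cvg_series_behead g : cvgn (series g) ->
  series (fun n => g n.+1) @ \oo --> limn (series g) - g 0%N.
Proof.
move=> cg.
have := cvg_sum_from (m := 1%N) cg; rewrite big_nat1 -(cvg_shiftS _ _).
by under eq_fun => n do rewrite big_add1/=.
Qed.

End Series.

(** * The metric space of sequences and its Borel sets *)

Lemma integral_invariant d (T : measurableType d) (R : realType)
    (mu : {measure set T -> \bar R}) (phi : T -> T) (f : T -> \bar R) :
  measurable_fun setT phi ->
  (forall A, measurable A -> mu (phi @^-1` A) = mu A) ->
  measurable_fun setT f -> mu.-integrable setT (f \o phi) ->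
  (\int[mu]_x f (phi x) = \int[mu]_x f x)%E.
Proof.
move=> mphi muphi mf fi.
rewrite [LHS](_ : _ = \int[mu]_(x in phi @^-1` setT) (f \o phi) x)%E//.
rewrite -(integral_pushforward mphi)//.
by apply: eq_measure_integral => A mA _; exact: muphi.
Qed.

(** * Truncation of the real line to the unit interval *)

Section Clamp.
Variable R : realType.
Implicit Types s t : R.

Lemma i01_itv (a : {i01 R}) : 0 <= \val a <= 1.
Proof. by apply/andP; split; [exact: (ge0 a) | exact: (le1 a)]. Qed.

Lemma max_min01_itv t : 0 <= Num.max 0 (Num.min t 1) <= 1.
Proof. by rewrite le_max lexx ge_max ler01 ge_min lexx orbT. Qed.

(** The point of the unit interval nearest to [t].  Composing with it turns a
    function on the unit interval into a function on the whole line with the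
    same Lipschitz constant. *)
Definition clamp01 t : {i01 R} :=
  let H := max_min01_itv t in
  Itv01 (proj1 (andP H)) (proj2 (andP H)).

Lemma clamp01E t : \val (clamp01 t) = Num.max 0 (Num.min t 1).
Proof. by []. Qed.

Lemma clamp01K t : 0 <= t <= 1 -> \val (clamp01 t) = t.
Proof.
by move=> /andP[t0 t1]; rewrite clamp01E min_l// max_r.
Qed.

Lemma clamp01_val (a : {i01 R}) : clamp01 (\val a) = a.
Proof. by apply: val_inj; apply: clamp01K; exact: i01_itv. Qed.

Lemma clamp01_dist s t : `|\val (clamp01 s) - \val (clamp01 t)| <= `|s - t|.
Proof.
have st := ler_norm (s - t); have ts := lerNnormlW (lexx `|s - t|).
rewrite !clamp01E; case: (leP s 1) => s1; case: (leP t 1) => t1;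
  rewrite ?(max_r ler01); case: (leP 0 s) => s0; case: (leP 0 t) => t0;
  by rewrite ler_norml; apply/andP; split; lra.
Qed.

Lemma lipschitz_continuous (h : R -> R) (L : R) : 0 <= L ->
  (forall s t, `|h s - h t| <= L * `|s - t|) -> continuous h.
Proof.
move=> L0 hL s; apply/cvgrPdist_lt => e e0.
near=> t; apply: le_lt_trans (hL _ _) _.
apply: (@le_lt_trans _ _ ((L + 1) * `|s - t|)).
  by rewrite ler_wpM2r// lerDl.
rewrite mulrC -ltr_pdivlMr; last by rewrite ltr_wpDl.
near: t; apply: (@cvgr_dist_lt _ _ _ _ _ id); first exact: cvg_id.
by rewrite divr_gt0// ltr_wpDl.
Unshelve. all: by end_near. Qed.

End Clamp.

Section Metric.
Variable R : realType.
Implicit Types (a b : {i01 R}) (x y : Omega R) (f : Omega R -> R).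

Lemma i01_dist_le1 a b : `|\val a - \val b| <= 1.
Proof.
have /andP[a0 a1] := i01_itv a; have /andP[b0 b1] := i01_itv b.
by rewrite ler_norml; apply/andP; split; lra.
Qed.

Lemma dist_series_cvg x y :
  cvgn (series (fun n => `|\val (x n) - \val (y n)| / 2 ^+ n.+1)).
Proof.
apply: (@series_le_cvg _ _ (geometric 2^-1 2^-1)) => [n|n|n|].
- by rewrite divr_ge0.
- by rewrite /= mulr_ge0.
- rewrite /= -exprS exprVn -[leRHS]mul1r ler_wpM2r// ?i01_dist_le1//.
- by apply: is_cvg_geometric_series; rewrite ger0_norm// invf_lt1// ltr1n.
Qed.

Lemma dist_ge0 x y : 0 <= dist x y.
Proof.
apply: limr_ge; first exact: dist_series_cvg.
by apply: nearW => n; apply: sumr_ge0 => i _; rewrite divr_ge0.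
Qed.

Lemma dist_le1 x y : dist x y <= 1.
Proof.
have h : series (geometric (2^-1 : R) 2^-1) @ \oo --> (1 : R).
  rewrite [X in _ --> X](_ : _ = 2^-1 * (1 - 2^-1)^-1); last by field.
  by apply: cvg_geometric_series; rewrite ger0_norm// invf_lt1// ltr1n.
rewrite -(cvg_lim _ h)//; apply: lim_series_le.
- exact: dist_series_cvg.
- exact: cvgP h.
- by move=> n; rewrite /= -exprS exprVn -[leRHS]mul1r ler_wpM2r// ?i01_dist_le1.
Qed.

Lemma dist_partial_le x y n :
  \sum_(0 <= i < n) (`|\val (x i) - \val (y i)| / 2 ^+ i.+1) <= dist x y.
Proof.
have nd : {homo series (fun n => `|\val (x n) - \val (y n)| / 2 ^+ n.+1)
    : n m / (n <= m)%N >-> n <= m}.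
  by apply: nondecreasing_series => i _ _; rewrite divr_ge0.
by have := nondecreasing_cvgn_le nd (@dist_series_cvg x y) n;
  rewrite seriesEnat.
Qed.

Lemma dist_head x y : `|\val (x 0%N) - \val (y 0%N)| <= 2 * dist x y.
Proof.
have := dist_partial_le x y 1.
by rewrite big_nat1 expr1 ler_pdivrMr// mulrC.
Qed.

Lemma dist_oshift x y : dist (oshift x) (oshift y) <= 2 * dist x y.
Proof.
apply: limr_le; first exact: dist_series_cvg.
apply: nearW => n; have := dist_partial_le x y n.+1.
rewrite -(ler_pM2l (ltr0n R 2)); apply: le_trans.
rewrite big_nat_recl//= mulrDr mulr_sumr -[leLHS]add0r lerD//.
by apply: ler_sum => i _; rewrite /oshift (exprS _ i.+1) invfM mulrCA mulVKf.
Qed.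

(** Two sequences that agree before rank [m] and are constantly [a],
    respectively [b], from there on are at distance at most |a - b| / 2^m. *)
Lemma dist_tail_cst (c a b : {i01 R}) m :
  dist (fun i => if (i < m)%N then c else a)
       (fun i => if (i < m)%N then c else b) <= `|\val a - \val b| / 2 ^+ m.
Proof.
set d := `|_|; have d0 : 0 <= d by exact: normr_ge0.
apply: limr_le; first exact: dist_series_cvg.
apply: nearW => n; have [nm|/ltnW mn] := leqP n m.
  rewrite big_nat big1 ?divr_ge0// => i /= in_.
  by rewrite (leq_trans in_ nm) subrr normr0 mul0r.
rewrite (big_cat_nat (n := m))//= big_nat big1 ?add0r => [|i /= im]; last first.
  by rewrite im subrr normr0 mul0r.
suff -> : \sum_(m <= i < n) (`|\val (if (i < m)%N then c else a) -
    \val (if (i < m)%N then c else b)| / 2 ^+ i.+1) = d / 2 ^+ m - d / 2 ^+ n.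
  by rewrite gerBl divr_ge0.
rewrite big_nat -[RHS]opprB -(telescope_sumr (fun i => d / 2 ^+ i) mn).
rewrite -sumrN [RHS]big_nat.
apply: eq_bigr => i /andP[mi _]; rewrite ltnNge mi -/d exprS.
by field; rewrite expf_neq0.
Qed.

(** The Lipschitz constant can be taken nonnegative. *)
Lemma lipschitz_distP f : lipschitz_dist f ->
  exists2 L : R, 0 <= L & forall x y, `|f x - f y| <= L * dist x y.
Proof.
move=> [L fL]; exists `|L| => // x y; apply: le_trans (fL x y) _.
by rewrite ler_wpM2r ?dist_ge0 ?ler_norm.
Qed.

Lemma measurable_lipschitz f : lipschitz_dist f ->
  measurable_fun setT (f : BorelOmega R -> R).
Proof.
move=> /lipschitz_distP[L L0 fL].
apply: (measurability _ (RGenOInfty.measurableE R)).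
move=> _ [_ [r ->] <-]; rewrite setTI; apply: sub_sigma_algebra => x /=.
rewrite in_itv/= andbT => rx; exists ((f x - r) / (L + 1)).
  by rewrite divr_gt0 ?subr_gt0//; lra.
move=> y; rewrite ltr_pdivlMr; last lra.
move=> dxy; rewrite in_itv/= andbT.
have := fL x y; rewrite ler_norml => /andP[_ fxy].
have := dist_ge0 x y; nra.
Qed.

Lemma bounded_lipschitz f : lipschitz_dist f ->
  exists M : R, forall x, `|f x| <= M.
Proof.
move=> /lipschitz_distP[L L0 fL]; exists (`|f (fun=> 0%:i01)| + L) => x.
rewrite -[X in `|X|](subrK (f (fun=> 0%:i01))) addrC.
apply: le_trans (ler_normD _ _) _; rewrite lerD2l.
apply: le_trans (fL _ _) _; rewrite -[leRHS]mulr1.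
by rewrite ler_wpM2l// dist_le1.
Qed.

Lemma integrable_lipschitz f (mu : probability (BorelOmega R) R) :
  lipschitz_dist f -> mu.-integrable setT (EFin \o f).
Proof.
move=> fL; have [M fM] := bounded_lipschitz fL.
apply: measurable_bounded_integrable => //.
- by apply: le_lt_trans (probability_le1 mu measurableT) _; exact: ltry.
- exact: measurable_lipschitz.
- exists M; split=> [|N MN x _]; first exact: num_real.
  by apply: le_trans (fM x) _; exact: ltW.
Qed.

Lemma measurable_oshift :
  measurable_fun setT (@oshift R : BorelOmega R -> BorelOmega R).
Proof.
apply: (@measurability _ _ (BorelOmega R) (BorelOmega R) setT (@oshift R)
  (@dist_open R : set (set (BorelOmega R)))) => //.
move=> _ [U Uo <-]; rewrite setTI; apply: sub_sigma_algebra => x /= Ux.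
have [e e0 xe] := Uo _ Ux; exists (e / 2) => [|y xy]; first by rewrite divr_gt0.
by apply: xe; apply: le_lt_trans (dist_oshift _ _) _; lra.
Qed.

Lemma lipschitz_oshift f : lipschitz_dist f ->
  lipschitz_dist (fun x => f (oshift x)).
Proof.
move=> /lipschitz_distP[L L0 fL]; exists (L * 2) => x y.
by apply: le_trans (fL _ _) _; rewrite -mulrA ler_wpM2l// dist_oshift.
Qed.

Lemma integral_oshift (mu : probability (BorelOmega R) R) f :
  shift_invariant mu -> lipschitz_dist f ->
  \int[mu]_x f (oshift x) = \int[mu]_x f x.
Proof.
move=> mus fL; have mf := measurable_lipschitz fL.
have mEf : measurable_fun setT (EFin \o f : BorelOmega R -> \bar R).
  exact/measurable_EFinP.
rewrite /Rintegral; congr fine.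
exact: (@integral_invariant _ (BorelOmega R) R mu _ (EFin \o f)
  measurable_oshift mus mEf (integrable_lipschitz mu (lipschitz_oshift fL))).
Qed.

End Metric.
(** * Potentials of product type *)

Section ProductPotential.
Variables (R : realType) (f_ : nat -> R -> R) (f : Omega R -> R).
Hypothesis abs_cvg : forall x : Omega R,
  cvgn (series (fun j => `|f_ j (\val (x j))|)).
Hypothesis iter_cvg : forall x : Omega R,
  cvgn (series (fun j => tail_sum f_ j (\val (x j)))).
Hypothesis f_eq : forall x : Omega R, f x = \sum_(0 <= j <oo) f_ j (\val (x j)).
Hypothesis f_lip : lipschitz_dist f.
Implicit Types (a b : {i01 R}) (x y : Omega R).

Let F := diagonal_sum f_.
Let u := product_subaction f_.

Lemma potential_series_cvg x : cvgn (series (fun j => f_ j (\val (x j)))).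
Proof. by apply: normed_cvg; exact: abs_cvg. Qed.

Lemma diagonal_sumE a : F (\val a) = f (fun=> a).
Proof. by rewrite f_eq. Qed.

(** Changing a sequence from rank [m] on, from constantly [b] to constantly
    [a], changes [f] by the difference of the tails of the series at [a] and
    at [b]: the Lipschitz bound on [f] thus controls these tails. *)
Lemma tail_lipschitz (L : R) m a b : 0 <= L ->
  (forall x y, `|f x - f y| <= L * dist x y) ->
  `|\sum_(m <= i <oo) f_ i (\val a) - \sum_(m <= i <oo) f_ i (\val b)|
    <= L * (`|\val a - \val b| / 2 ^+ m).
Proof.
move=> L0 fL.
pose s (c : {i01 R}) : Omega R := fun i => if (i < m)%N then b else c.
have fs c : f (s c) = \sum_(0 <= i < m) f_ i (\val b)
    + \sum_(m <= i <oo) f_ i (\val c).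
  rewrite f_eq (sum_split m (@potential_series_cvg (s c))); congr (_ + _).
    by rewrite big_nat [RHS]big_nat; apply: eq_bigr => i /= im; rewrite /s im.
  apply: eq_limn => n /=.
  rewrite big_nat [RHS]big_nat; apply: eq_bigr => i /andP[mi _].
  by rewrite /s ltnNge mi.
have := fL (s a) (s b); rewrite !fs opprD addrACA subrr add0r.
move=> /le_trans; apply.
by rewrite ler_wpM2l// dist_tail_cst.
Qed.

Lemma diagonal_sum_lipschitz : exists2 L : R, 0 <= L &
  forall a b, `|F (\val a) - F (\val b)| <= L * `|\val a - \val b|.
Proof.
have [L L0 fL] := lipschitz_distP f_lip; exists L => // a b.
by have := @tail_lipschitz L 0%N a b L0 fL; rewrite expr0 divr1.
Qed.

(** The [j]-th term of [u] is Lipschitz with the constant L/2^(j+1) that weighs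
    the [j]-th coordinate in [dist]. *)
Lemma product_subaction_lipschitz : lipschitz_dist u.
Proof.
have [L L0 fL] := lipschitz_distP f_lip; exists L => x y.
pose g j := tail_sum f_ j (\val (x j)) - tail_sum f_ j (\val (y j)).
pose d j := `|\val (x j) - \val (y j)| / 2 ^+ j.+1.
have gd j : `|g j| <= L * d j by exact: tail_lipschitz.
have cd : cvgn (series (fun j => L * d j)).
  exact: (@is_cvg_seriesZ R d L (@dist_series_cvg _ x y)).
have cg : cvgn [normed series g].
  apply: series_le_cvg cd => [j|j|j]; last exact: gd.
    exact: normr_ge0.
  exact: le_trans (normr_ge0 _) (gd j).
have -> : u x - u y = limn (series g).
  exact/esym/(lim_seriesB (@iter_cvg x) (@iter_cvg y)).
apply: le_trans (lim_series_norm cg) _.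
have -> : L * dist x y = limn (series (fun j => L * d j)).
  exact/esym/(@lim_seriesZ R d L (@dist_series_cvg _ x y)).
exact: lim_series_le.
Qed.

Lemma tail_sumS j a :
  tail_sum f_ j (\val a) = f_ j.+1 (\val a) + tail_sum f_ j.+1 (\val a).
Proof. exact: (sum_from_recl _ (@potential_series_cvg (fun=> a))). Qed.

(** The subaction [u] makes [f] cohomologous to the function [F] of the first
    coordinate alone. *)
Lemma subaction_identity x : f x + u x - u (oshift x) = F (\val (x 0%N)).
Proof.
set y := oshift x.
have fE : f x = f_ 0%N (\val (x 0%N))
    + limn (series (fun j => f_ j.+1 (\val (y j)))).
  rewrite (cvg_lim _ (cvg_series_behead (@potential_series_cvg x)))// f_eq.
  by rewrite addrC subrK.
have uE : u x = tail_sum f_ 0%N (\val (x 0%N))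
    + limn (series (fun j => tail_sum f_ j.+1 (\val (y j)))).
  rewrite (cvg_lim _ (cvg_series_behead (@iter_cvg x)))//.
  by rewrite addrC subrK.
have cf : cvgn (series (fun j => f_ j.+1 (\val (y j)))).
  exact: cvgP (cvg_series_behead (@potential_series_cvg x)).
have ct : cvgn (series (fun j => tail_sum f_ j.+1 (\val (y j)))).
  exact: cvgP (cvg_series_behead (@iter_cvg x)).
have uyE : u y = limn (series (fun j => f_ j.+1 (\val (y j))))
    + limn (series (fun j => tail_sum f_ j.+1 (\val (y j)))).
  rewrite -(lim_seriesD cf ct); apply: eq_limn => n /=.
  by apply: eq_bigr => j _; rewrite tail_sumS.
rewrite fE uE uyE /F /diagonal_sum.
rewrite (sum_from_recl _ (@potential_series_cvg (fun=> x 0%N))) /tail_sum.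
by ring.
Qed.

(** For an invariant measure the coboundary term integrates to zero. *)
Lemma integral_potential (mu : probability (BorelOmega R) R) :
  shift_invariant mu -> \int[mu]_x f x = \int[mu]_x F (\val (x 0%N)).
Proof.
move=> mus; have uL := product_subaction_lipschitz.
have fi := integrable_lipschitz mu f_lip.
have ui := integrable_lipschitz mu uL.
have uoi := integrable_lipschitz mu (lipschitz_oshift uL).
have -> : \int[mu]_x F (\val (x 0%N)) = \int[mu]_x (f x + u x - u (oshift x)).
  by apply: eq_Rintegral => x _; rewrite subaction_identity.
rewrite (@RintegralB _ _ _ mu setT (fun x => f x + u x))//; last first.
  by rewrite /comp; under eq_fun do rewrite EFinD; exact: integrableD.
by rewrite RintegralD// (integral_oshift mus uL) addrK.
Qed.

Lemma diagonal_sum_clamp_lipschitz : exists2 L : R, 0 <= L &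
  forall s t, `|F (\val (clamp01 s)) - F (\val (clamp01 t))| <= L * `|s - t|.
Proof.
have [L L0 FL] := diagonal_sum_lipschitz; exists L => // s t.
by apply: le_trans (FL _ _) _; rewrite ler_wpM2l// clamp01_dist.
Qed.

Lemma diagonal_sum_max : exists a, forall b, F (\val b) <= F (\val a).
Proof.
have [L L0 FL] := diagonal_sum_clamp_lipschitz.
pose G t := F (\val (clamp01 t)).
have cG : continuous G := lipschitz_continuous L0 FL.
have [c c01 cmax] := EVT_max ler01 (continuous_subspaceT cG).
exists (clamp01 c) => b.
have := cmax (\val b); rewrite /G clamp01_val; apply.
by rewrite in_itv/= i01_itv.
Qed.

Lemma max_valueE a : (forall b, F (\val b) <= F (\val a)) ->
  max_value f = F (\val a).
Proof.
move=> amax; rewrite /max_value.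
set S := [set r | _].
have SF : is_max S (F (\val a)).
  split.
    (* the maximum is attained by the Dirac mass at a constant sequence *)
    pose p : BorelOmega R := (fun=> a) : Omega R.
    exists (dirac p : probability (BorelOmega R) R) => //.
    rewrite diagonal_sumE /Rintegral integral_dirac//.
      by rewrite diracT mul1e.
    by have mf := measurable_lipschitz f_lip; exact/measurable_EFinP.
  move=> _ [mu mus ->]; rewrite (integral_potential mus).
  have gL : lipschitz_dist (fun x : Omega R => F (\val (x 0%N))).
    have [L L0 FL] := diagonal_sum_lipschitz; exists (L * 2) => x y.
    apply: le_trans (FL _ _) _; rewrite -mulrA ler_wpM2l//.
    exact: dist_head.
  have mu1 : fine (mu setT) = 1 by rewrite probability_setT.
  have <- : \int[mu]_x F (\val a) = F (\val a).
    by rewrite Rintegral_cst// mu1 mulr1.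
  apply: le_Rintegral => //.
    exact: integrable_lipschitz.
  by apply: integrable_lipschitz; exists 0 => x y; rewrite subrr normr0 mul0r.
by apply: xget_unique => // y [Sy uy]; apply/le_anti/andP; split;
  [apply: SF.2 | apply: uy; exact: SF.1].
Qed.

End ProductPotential.

(** * Laplace's principle on an interval *)

Section Laplace.
Variables (R : realType) (G : R -> R) (L : R).
Hypothesis L0 : 0 <= L.
Hypothesis GL : forall s t, `|G s - G t| <= L * `|s - t|.
Implicit Types (A : set R) (beta : R).

Local Notation leb := (@lebesgue_measure R).

Let expG_cont beta : continuous (fun a => expR (beta * G a)).
Proof.
have cG := lipschitz_continuous L0 GL.
move=> a; apply: continuous_comp; last exact: continuous_expR.
by apply: cvgM; [exact: cvg_cst | exact: cG].
Qed.

Lemma exp_integrable beta A : measurable A -> A `<=` `[0, 1] ->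
  leb.-integrable A (EFin \o (fun a => expR (beta * G a))).
Proof.
move=> mA A01; apply: (@integrableS _ _ R leb `[0, 1]%classic) => //.
apply: continuous_compact_integrable; first exact: segment_compact.
exact/continuous_subspaceT/expG_cont.
Qed.

Lemma interval01_measurable A : interval01 A -> measurable A.
Proof. by move=> [+ _ _]; exact: is_interval_measurable. Qed.

Lemma interval01_unit : interval01 (`[0, 1] : set R).
Proof.
split=> //; first exact: interval_is_interval.
by exists 0, 1; rewrite /= !in_itv/= !lexx ler01 ltr01.
Qed.

Lemma interval01_has_sup A : interval01 A -> has_sup (G @` A).
Proof.
move=> [_ A01 [a [_ [Aa _ _]]]]; split; first by exists (G a); exists a.
exists (G 0 + L) => _ [t /A01 + <-]; rewrite /= in_itv/= => /andP[t0 t1].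
rewrite -lerBlDl; apply: le_trans (ler_norm _) _.
by apply: le_trans (GL _ _) _; rewrite subr0 ger0_norm// ler_piMr.
Qed.

(** On a short enough segment of [A] with an endpoint at [p], of length [d], the
    function [G] is at least [G p - e]. *)
Lemma exp_integral_ge A p (e : R) : interval01 A -> A p -> 0 < e ->
  exists2 d : R, 0 < d & forall beta, 0 < beta ->
    d * expR (beta * (G p - e)) <= \int[leb]_(a in A) expR (beta * G a).
Proof.
move=> iA Ap e0; have mA := interval01_measurable iA.
have [isA A01 [a [b [Aa Ab ab]]]] := iA.
have [c [d [cd cdA near_p]]] : exists c d, [/\ c < d, `[c, d] `<=` A &
    forall t, `[c, d]%classic t -> L * `|t - p| <= e].
  have L1 : 0 < L + 1 by rewrite ltr_wpDl.
  have close r t : r <= e / (L + 1) -> `|t - p| <= r -> L * `|t - p| <= e.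
    move=> re tr; apply: (@le_trans _ _ ((L + 1) * (e / (L + 1)))).
      by apply: ler_pM => //; [rewrite lerDl | exact: le_trans re].
    by rewrite mulrC divfK// gt_eqF.
  (* the segment goes towards [b] if [p] is on its left, else towards [a] *)
  have [pb|bp] := ltP p b.
    pose r := Num.min (b - p) (e / (L + 1)).
    have r0 : 0 < r by rewrite lt_min subr_gt0 pb divr_gt0.
    have rb : r <= b - p by rewrite ge_min lexx.
    exists p, (p + r); split; first by rewrite ltrDl.
      move=> t /=; rewrite in_itv/= => /andP[pt tr].
      by apply: (isA p b) => //; rewrite pt; lra.
    move=> t /=; rewrite in_itv/= => /andP[pt tr].
    apply: (close r); first by rewrite ge_min lexx orbT.
    by rewrite ger0_norm; lra.
  have ap : a < p by exact: lt_le_trans bp.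
  pose r := Num.min (p - a) (e / (L + 1)).
  have r0 : 0 < r by rewrite lt_min subr_gt0 ap divr_gt0.
  have ra : r <= p - a by rewrite ge_min lexx.
  exists (p - r), p; split; first by rewrite gtrBl.
    move=> t /=; rewrite in_itv/= => /andP[rt tp].
    by apply: (isA a p) => //; rewrite tp andbT; lra.
  move=> t /=; rewrite in_itv/= => /andP[rt tp].
  apply: (close r); first by rewrite ge_min lexx orbT.
  by rewrite ler0_norm; lra.
exists (d - c); first by rewrite subr_gt0.
move=> beta b0.
have cd01 : `[c, d] `<=` `[0, 1] by exact: subset_trans A01.
have mcd : measurable (`[c, d] : set R) by exact: measurable_itv.
apply: (@le_trans _ _ (\int[leb]_(a in `[c, d]) expR (beta * G a))).
  have -> : (d - c) * expR (beta * (G p - e)) =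
      \int[leb]_(a in `[c, d]) expR (beta * (G p - e)).
    have lcd : fine (leb `[c, d]) = d - c.
      by rewrite lebesgue_measure_itv/= lte_fin cd.
    by rewrite Rintegral_cst// [RHS]mulrC -lcd.
  apply: le_Rintegral => //.
  - apply: continuous_compact_integrable; first exact: segment_compact.
    by apply: continuous_subspaceT => t; exact: cvg_cst.
  - exact: exp_integrable.
  move=> t tcd; rewrite ler_expR ler_wpM2l ?(ltW b0)//.
  have := le_trans (GL t p) (near_p t tcd); rewrite ler_norml => /andP[+ _].
  by lra.
rewrite /Rintegral fine_le//.
- exact/integrable_fin_num/exp_integrable.
- exact/integrable_fin_num/exp_integrable.
apply: ge0_subset_integral => //.
exact: measurable_int (exp_integrable beta mA A01).
Qed.

Lemma exp_integral_gt0 A beta : interval01 A -> 0 < beta ->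
  0 < \int[leb]_(a in A) expR (beta * G a).
Proof.
move=> iA b0; have [_ _ [a [_ [Aa _ _]]]] := iA.
have [d d0 /(_ _ b0)] := exp_integral_ge iA Aa ltr01.
by apply: lt_le_trans; rewrite mulr_gt0// expR_gt0.
Qed.

Lemma exp_integral_le A beta : interval01 A -> 0 < beta ->
  \int[leb]_(a in A) expR (beta * G a) <= expR (beta * sup (G @` A)).
Proof.
move=> iA b0; have mA := interval01_measurable iA.
have [_ A01 _] := iA.
apply: (@le_trans _ _ (\int[leb]_(a in A) expR (beta * sup (G @` A)))).
  apply: le_Rintegral => //.
  - exact: exp_integrable.
  - apply: (@integrableS _ _ R leb `[0, 1]%classic) => //.
    apply: continuous_compact_integrable; first exact: segment_compact.
    by apply: continuous_subspaceT => t; exact: cvg_cst.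
  move=> t At; rewrite ler_expR ler_wpM2l ?(ltW b0)//.
  by apply: (sup_upper_bound (interval01_has_sup iA)); exists t.
have l01 : leb `[0, 1] = 1%E.
  by rewrite lebesgue_measure_itv/= lte_fin ltr01 sube0.
have A1 : (leb A <= 1)%E by rewrite -l01 le_measure ?inE.
rewrite Rintegral_cst// ler_piMr ?expR_ge0//.
by rewrite -[leRHS]/(fine 1%E) fine_le// ge0_fin_numE// (le_lt_trans A1) ?ltry.
Qed.

Lemma laplace_interval A : interval01 A ->
  beta^-1 * ln (\int[leb]_(a in A) expR (beta * G a))
    @[beta --> +oo] --> sup (G @` A).
Proof.
move=> iA; set s := sup _.
apply/cvgrPdist_le => e e0.
have e20 : 0 < e / 2 by rewrite divr_gt0.
have [_ [p Ap <-] sp] := sup_adherent e20 (interval01_has_sup iA).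
have e40 : 0 < e / 4 by rewrite divr_gt0.
have [d d0 Id] := exp_integral_ge iA Ap e40.
near=> beta.
have b0 : 0 < beta by near: beta; exact: nbhs_pinfty_gt.
have be : - ln d <= beta * (e / 4).
  by rewrite -ler_pdivrMr//; near: beta; exact: nbhs_pinfty_ge.
have I0 := exp_integral_gt0 iA b0.
have up : ln (\int[leb]_(a in A) expR (beta * G a)) <= beta * s.
  by rewrite -[leRHS]expRK ler_ln ?posrE ?expR_gt0// exp_integral_le.
have lo : ln d + beta * (G p - e / 4) <=
    ln (\int[leb]_(a in A) expR (beta * G a)).
  rewrite -[X in _ + X]expRK -lnM ?posrE ?expR_gt0// ler_ln ?posrE//.
    exact: Id.
  by rewrite mulr_gt0 ?expR_gt0.
rewrite ler_norml; set I := ln _ in up lo *.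
have bI : beta * (beta^-1 * I) = I by rewrite mulVKf// gt_eqF.
have bsp : beta * (s - e / 2) < beta * G p by rewrite ltr_pM2l.
have be0 : 0 < beta * e by rewrite mulr_gt0.
by apply/andP; split; rewrite -(ler_pM2l b0) mulrBr bI; lra.
Unshelve. all: by end_near. Qed.

End Laplace.

(** * Large deviations of the product measures *)

Section LargeDeviations.
Variable R : realType.

Lemma ln_prod (I : Type) (s : seq I) (r : I -> R) : (forall i, 0 < r i) ->
  ln (\prod_(i <- s) r i) = \sum_(i <- s) ln (r i).
Proof.
move=> r0; elim: s => [|i s IHs]; first by rewrite !big_nil ln1.
by rewrite !big_cons lnM ?posrE ?prodr_gt0// IHs.
Qed.

(** The function [G] stands for a Lipschitz extension of [F] to the line. *)
Lemma gibbsE (F G : R -> R) (L beta : R) (A : set R) : 0 <= L ->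
  (forall s t, `|G s - G t| <= L * `|s - t|) ->
  {in `[0, 1], F =1 G} -> interval01 A ->
  gibbs F beta A = ((\int[lebesgue_measure]_(a in A) expR (beta * G a))
    / \int[lebesgue_measure]_(a in `[0%R, 1%R]) expR (beta * G a))%:E.
Proof.
move=> L0 GL FG iA; have mA := interval01_measurable iA.
have [_ A01 _] := iA.
rewrite /gibbs setIidl//.
have -> : \int[lebesgue_measure]_(b in `[0%R, 1%R]) expR (beta * F b) =
    \int[lebesgue_measure]_(b in `[0%R, 1%R]) expR (beta * G b).
  by apply: eq_Rintegral => b; rewrite inE/= => b01; rewrite FG.
set Z := Rintegral _ _ _.
have iG := exp_integrable L0 GL beta mA A01.
transitivity (\int[lebesgue_measure]_(a in A) (expR (beta * G a) / Z)%:E)%E.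
  by apply: eq_integral => a; rewrite inE => /A01 a01; rewrite FG.
rewrite -RintegralZr// /Rintegral fineK//.
apply: integrable_fin_num.
- exact: mA.
- exact: (@integrableZr _ _ R lebesgue_measure A mA Z^-1 _ iG).
Qed.

(** The infimum over a cylinder of a sum of nonnegative costs of the
    coordinates: the free coordinates are put at a point of zero cost. *)
Lemma ereal_inf_cylinder (c : {i01 R} -> R) (a0 : {i01 R}) n
    (A : 'I_n -> set R) (v : 'I_n -> R) :
  (forall a, 0 <= c a) -> c a0 = 0 ->
  (forall k a, A k (\val a) -> v k <= c a) ->
  (forall k e, 0 < e -> exists2 a, A k (\val a) & c a < v k + e) ->
  ereal_inf [set (\sum_(0 <= j <oo) (c (x j))%:E)%E | x in cylinder A] =
    (\sum_k v k)%:E.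
Proof.
move=> c0 ca0 vlow vadh; apply/le_anti/andP; split; last first.
  apply: le_ereal_inf_tmp => _ [x Ax <-].
  apply: (@le_trans _ _ (\sum_(0 <= j < n) (c (x j))%:E)%E); last first.
    by apply: nneseries_lim_ge => j _; rewrite lee_fin.
  by rewrite big_mkord sumEFin lee_fin; apply: ler_sum => k _; exact: vlow.
apply/lee_addgt0Pr => e e0.
(* an excess e/(n+1) for each of the n constrained coordinates; n may be 0 *)
have d0 : 0 < e / n.+1%:R by rewrite divr_gt0.
have /choice[a Aa] k : exists b, A k (\val b) /\ c b < v k + e / n.+1%:R.
  by have [b Ab cb] := vadh k _ d0; exists b.
pose x : Omega R := fun j => if insub j is Some k then a k else a0.
have xk (k : 'I_n) : x k = a k by rewrite /x valK.
apply: ge_ereal_inf; exists (\sum_(0 <= j <oo) (c (x j))%:E)%E.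
  by exists x => // k; rewrite /= xk; exact: (Aa k).1.
rewrite (nneseries_split 0%N n) => [|j _]; last by rewrite lee_fin.
rewrite add0n [X in (_ + X)%E]eseries0 ?adde0 => [|j nj _]; last first.
  by rewrite /x insubN ?ca0// -leqNgt.
rewrite big_mkord sumEFin -EFinD lee_fin.
apply: (@le_trans _ _ (\sum_(k < n) (v k + e / n.+1%:R))).
  by apply: ler_sum => k _; rewrite xk ltW// (Aa k).2.
rewrite big_split/= lerD2l sumr_const card_ord -[leLHS]mulr_natr.
by rewrite -mulrA ler_piMr ?(ltW e0)// mulrC ler_pdivrMr// mul1r ler_nat.
Qed.

End LargeDeviations.

Theorem proposition7 (R : realType) (f_ : nat -> R -> R) (f : Omega R -> R)
    (abs_cvg : forall x : Omega R,
      cvgn (series (fun j => `|f_ j (\val (x j))|)))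
    (iter_cvg : forall x : Omega R,
      cvgn (series (fun j => tail_sum f_ j (\val (x j)))))
    (f_eq : forall x : Omega R, f x = \sum_(0 <= j <oo) f_ j (\val (x j)))
    (f_lip : lipschitz_dist f)
    (mu : R -> probability (BorelOmega R) R)
    (mu_prod : forall beta : R, 0 < beta ->
      is_product_measure (gibbs (diagonal_sum f_) beta) (mu beta)) :
  let F := diagonal_sum f_ in
  let u := product_subaction f_ in
  let I := rate f u in
  [/\ calibrated_subaction f u,
      forall x : Omega R,
        I x = (\sum_(0 <= j <oo)
                 (- (\sum_(0 <= i <oo) f_ i (\val (x j))) + max_value f)%R%:E)%E
        /\ I x = (\sum_(0 <= j <oo) (- F (\val (x j)) + max_value f)%R%:E)%E
    & forall (n : nat) (A : 'I_n -> set R), (0 < n)%N ->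
        (forall k, interval01 (A k)) ->
        (((beta^-1)%:E * lne (mu beta (cylinder A)))%E
           @[beta --> +oo%R]) --> (- ereal_inf (I @` cylinder A))%E].
Proof.
move=> F u I.
have uid := subaction_identity abs_cvg iter_cvg f_eq.
have [a0 a0max] := diagonal_sum_max abs_cvg f_eq f_lip.
have mE := max_valueE abs_cvg iter_cvg f_eq f_lip a0max.
have IE x : I x = (\sum_(0 <= j <oo) (- F (\val (x j)) + max_value f)%R%:E)%E.
  rewrite /I /rate; apply: eq_eseriesr => j _; congr (_%:E).
  have xj : iter j (@oshift R) x 0%N = x j.
    have sh k y : iter k (@oshift R) y =1 fun i => y (k + i)%N.
      by elim: k => [//|k IHk] i; rewrite iterS /oshift IHk addSnnS.
    by rewrite sh addn0.
  by rewrite -xj /F -uid iterS /u; ring.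
split=> [x|x|n A n0 iA].
- have caE a : f (ocons a x) + u (ocons a x) - u x = F (\val a).
    exact: (uid (ocons a x)).
  rewrite mE; split; first by exists a0 => //; exact: caE.
  by move=> _ [a _ <-]; rewrite caE; exact: a0max.
- by split; rewrite IE.
have [L L0 GL] := diagonal_sum_clamp_lipschitz abs_cvg f_eq f_lip.
pose G t := F (\val (clamp01 t)).
have FG : {in `[0, 1], F =1 G}.
  by move=> t; rewrite in_itv/= => t01; rewrite /G clamp01K.
have GF (a : {i01 R}) : G (\val a) = F (\val a) by rewrite /G clamp01_val.
pose J A beta := \int[lebesgue_measure]_(a in A) expR (beta * G a).
have J0 B beta : interval01 B -> 0 < beta -> 0 < J B beta.
  by move=> iB b0; exact: (exp_integral_gt0 L0 GL).
have i01 := interval01_unit R.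
pose s k := sup (G @` A k).
have supG : sup (G @` `[0, 1]) = max_value f.
  rewrite mE; apply/le_anti/andP; split.
    apply: ge_sup; first by exists (G 0), 0 => //=; rewrite in_itv/= lexx ler01.
    by move=> _ [t _ <-]; exact: a0max.
  apply: (sup_upper_bound (interval01_has_sup L0 GL i01)).
  by exists (\val a0); [rewrite /= in_itv/= i01_itv|exact: GF].
have infE : ereal_inf (I @` cylinder A) = (\sum_k (max_value f - s k))%:E.
  pose c (a : {i01 R}) := max_value f - F (\val a).
  have -> : I @` cylinder A =
      [set (\sum_(0 <= j <oo) (c (x j))%:E)%E | x in cylinder A].
    apply: eq_imagel => x _; rewrite IE; apply: eq_eseriesr => j _.
    by rewrite /c addrC.
  apply: (@ereal_inf_cylinder _ c a0) => [a||k a Aka|k e e0]; rewrite /c.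
  - by rewrite subr_ge0 mE; exact: a0max.
  - by rewrite mE subrr.
  - rewrite lerD2l lerN2 -GF.
    apply: (sup_upper_bound (interval01_has_sup L0 GL (iA k))).
    by exists (\val a).
  - have [_ [t At <-] st] := sup_adherent e0 (interval01_has_sup L0 GL (iA k)).
    have t01 : 0 <= t <= 1.
      by have [_ /(_ _ At) + _] := iA k; rewrite /= in_itv.
    exists (clamp01 t); first by rewrite clamp01K.
    by have stG : s k - e < G t := st; rewrite -/(G t); lra.
have limJ B : interval01 B ->
    beta^-1 * ln (J B beta) @[beta --> +oo] --> sup (G @` B).
  exact: (laplace_interval L0 GL).
have lim : \sum_k (beta^-1 * ln (J (A k) beta)
             - beta^-1 * ln (J `[0, 1]%classic beta))
    @[beta --> +oo] --> \sum_k (s k - max_value f).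
  apply: (cvg_big (op := +%R)) => [|k _]; first exact: add_continuous.
  by apply: cvgB; [exact: limJ | rewrite -supG; exact: limJ].
have muE beta : 0 < beta -> ((beta^-1)%:E * lne (mu beta (cylinder A)))%E =
    (\sum_k (beta^-1 * ln (J (A k) beta)
             - beta^-1 * ln (J `[0, 1]%classic beta)))%:E.
  move=> b0.
  rewrite (mu_prod beta b0); last by move=> k; exact: interval01_measurable.
  pose q k := J (A k) beta / J `[0, 1]%classic beta.
  have q0 k : 0 < q k by rewrite divr_gt0// J0.
  have -> : (\prod_k gibbs F beta (A k) = (\prod_k q k)%:E)%E.
    by rewrite -prodEFin; apply: eq_bigr => k _; exact: (gibbsE _ L0 GL).
  rewrite lne_EFin ?prodr_gt0//.
  transitivity (beta^-1 * ln (\prod_k q k))%:E => //.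
  congr (_%:E); rewrite ln_prod// mulr_sumr; apply: eq_bigr => k _.
  by rewrite ln_div ?posrE ?J0// mulrBr.
rewrite infE -EFinN -sumrN.
under eq_bigr do rewrite opprB.
apply: cvg_EFin.
  by near=> beta; rewrite muE//; near: beta; exact: nbhs_pinfty_gt.
apply: cvg_trans lim; apply: near_eq_cvg; near=> beta.
by rewrite /= muE//; near: beta; exact: nbhs_pinfty_gt.
Unshelve. all: by end_near. Qed.
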